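(* Let $(E,f)$ be a polymatroid with $f(E)>0$ and $\mathbf{1}(x)=\sum_{e\in E}x_e$. Then the monotone path polytope $\mathrm{MPP}_{\mathbf{1}}(P_f)$ is normally equivalent to the max-slope pivot rule polytope $\mathrm{PP}_{P_f,\mathbf{1}}$.
   Context: Polymatroid: $f:2^E\to\mathbb{R}_{\ge0}$, $f(\emptyset)=0$, $f(A)\le f(A\cup B)\le f(A)+f(B)-f(A\cap B)$; $P_f=\{x\ge0:\sum_{e\in A}x_e\le f(A)\ \forall A\subseteq E\}$. $\mathrm{MPP}_c(P)=\{2\int_I\gamma(s)\,ds\}$ over continuous sections $\gamma:I=\{\langle c,x\rangle:x\in P\}\to P$ with $\langle c,\gamma(s)\rangle=s$. For a polytope $P$ with vertex set $V(P)$ and linear $c$, let $N(v)$ be the set of vertices $u$ with $[u,v]$ an edge of $P$ and $\langle c,u\rangle>\langle c,v\rangle$. An arborescence of $(P,c)$ is a map $\mathcal{A}:V(P)\to V(P)$ with $\mathcal{A}(v)=v$ if $v$ maximizes $c$ over $P$ and $\mathcal{A}(v)\in N(v)$ otherwise. Set $\Psi(\mathcal{A})=\sum_{v:\mathcal{A}(v)\neq v}\frac{\mathcal{A}(v)-v}{\langle c,\mathcal{A}(v)-v\rangle}$ and $\mathrm{PP}_{P,c}=\mathrm{conv}\{\Psi(\mathcal{A}):\mathcal{A}\text{ arborescence of }(P,c)\}$. Normally equivalent: same normal fan. *)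

(* Defs.v *)
From HB Require Import structures.
From mathcomp Require Import all_boot all_order all_algebra.
From mathcomp Require Import all_classical all_reals all_analysis.

Set Implicit Arguments.
Unset Strict Implicit.
Unset Printing Implicit Defensive.

Import Order.TTheory GRing.Theory Num.Theory.
Import numFieldNormedType.Exports.

Local Open Scope classical_set_scope.
Local Open Scope ring_scope.

Section Polytopes.
Context {R : realType} {E : finType}.
Local Notation V := {ffun E -> R}.
Implicit Types (P Q F S : set V) (c w u v x : V).

Definition dotp c x : R := \sum_(e : E) c e * x e.

Definition ones : V := [ffun => 1].

Definition convex_hull S : set V := smallest (@convex_set R V) S.

Definition segment u v : set V :=
  [set x | exists t : R, 0 <= t <= 1 /\ x = (1 - t) *: u + t *: v].

Definition argmax P w : set V :=
  [set x | P x /\ forall y, P y -> dotp w y <= dotp w x].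

(* The nonempty faces of P; P itself is the face of w = 0. *)
Definition face P F : Prop := F !=set0 /\ exists w, F = argmax P w.

Definition vertices P : set V := [set v | face P [set v]].

Definition edge P u v : Prop := u <> v /\ face P (segment u v).

Definition normal_cone P F : set V := [set w | F `<=` argmax P w].

Definition normal_fan P : set (set V) :=
  [set C | exists F, face P F /\ C = normal_cone P F].

Definition normally_equivalent P Q : Prop := normal_fan P = normal_fan Q.

Definition levels P c : set R := dotp c @` P.

(* Only the values of gamma on the interval levels P c are relevant.
   Continuity into R^E is continuity of every coordinate. *)
Definition section P c (gamma : R -> V) : Prop :=
  [/\ forall s, levels P c s -> P (gamma s),
      forall s, levels P c s -> dotp c (gamma s) = s
    & forall e : E, {within levels P c, continuous (fun s : R => gamma s e)}].

Definition integral_section P c (gamma : R -> V) : V :=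
  [ffun e => \int[lebesgue_measure]_(s in levels P c) gamma s e].

Definition MPP P c : set V :=
  [set x | exists gamma, section P c gamma /\
                         x = 2 *: integral_section P c gamma].

Definition improving_neighbors P c v : set V :=
  [set u | [/\ vertices P u, edge P u v & dotp c v < dotp c u]].

(* Only the values of A on vertices P are relevant; they lie in vertices P. *)
Definition arborescence P c (A : V -> V) : Prop :=
  forall v, vertices P v ->
    (argmax P c v -> A v = v) /\
    (~ argmax P c v -> improving_neighbors P c v (A v)).

(* Finitely supported sum: the vertex set of a polytope is finite. *)
Definition Psi P c (A : V -> V) : V :=
  \sum_(v \in [set v | vertices P v /\ A v <> v])
     (dotp c (A v - v))^-1 *: (A v - v).

Definition pivot_polytope P c : set V :=
  convex_hull [set x | exists A, arborescence P c A /\ x = Psi P c A].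

Definition polymatroid (f : {set E} -> R) : Prop :=
  [/\ forall A, 0 <= f A,
      f finset.set0 = 0
    & forall A B, f A <= f (A :|: B) /\
                  f (A :|: B) <= f A + f B - f (A :&: B)].

Definition polymatroid_polytope (f : {set E} -> R) : set V :=
  [set x | (forall e, 0 <= x e) /\
           forall A : {set E}, \sum_(e in A) x e <= f A].

End Polytopes.

(* Main.v *)
Require Import Defs.
From mathcomp Require Import all_boot all_order all_algebra.
From mathcomp Require Import finmap all_classical all_reals all_analysis.
From mathcomp Require Import ring lra.

(** Every improving edge of a polymatroid polytope at a vertex v points in a
    coordinate direction e_i, where i lies outside [tspan v], the union of the
    tight sets of v, and all such i occur; the slope of w along that edge is
    w_i.  Hence the face of the pivot polytope selected by w is determined by
    the sets of w-maximal indices outside [tspan v], over all vertices v, and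
    inclusion of faces is inclusion of these sets ([refines_steepest]).

    On the monotone path side, the optimal sections for w are those all of
    whose points are w-maximal on their level; these points are exactly the
    greedy ones, and following w-steepest edges from 0 produces an optimal
    section.  If w' breaks a w-steepest tie at v, a greedy path for w reaches a
    vertex whose free indices include the tied ones and then leaves it in a
    direction which is not optimal for w'.  Conversely, a point that is greedy
    for w but not for w' exhibits such a broken tie.  So inclusion of faces is
    given by the same relation on both sides, and the normal fans agree. *)

Set Implicit Arguments.
Unset Strict Implicit.
Unset Printing Implicit Defensive.

Import Order.TTheory GRing.Theory Num.Theory.
Import numFieldNormedType.Exports.

Local Open Scope ring_scope.

(** * Linear forms and coordinate sums *)

Section LinearForms.
Context {R : realType} {E : finType}.
Local Notation V := {ffun E -> R}.
Implicit Types (c w x y : V) (A B : {set E}).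

Definition mass x A : R := \sum_(e in A) x e.

Definition basis_vec (i : E) : V := [ffun e => (e == i)%:R].

Lemma dotpC x y : dotp x y = dotp y x.
Proof. by apply: eq_bigr => e _; rewrite mulrC. Qed.

Lemma dotpDr c x y : dotp c (x + y) = dotp c x + dotp c y.
Proof. by rewrite -big_split; apply: eq_bigr => e _; rewrite ffunE mulrDr. Qed.

Lemma dotpZr c a x : dotp c (a *: x) = a * dotp c x.
Proof. by rewrite mulr_sumr; apply: eq_bigr => e _; rewrite ffunE mulrCA. Qed.

Lemma dotpBr c x y : dotp c (x - y) = dotp c x - dotp c y.
Proof. by rewrite -scaleN1r dotpDr dotpZr mulN1r. Qed.

Lemma dotp_sumr c (I : Type) (s : seq I) (F : I -> V) :
  dotp c (\sum_(i <- s) F i) = \sum_(i <- s) dotp c (F i).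
Proof.
elim/big_rec2: _ => [|i _ y _ <-]; last by rewrite dotpDr.
by apply: big1 => e _; rewrite ffunE mulr0.
Qed.

Lemma dotp_basis c i : dotp c (basis_vec i) = c i.
Proof.
rewrite /dotp (bigD1 i)//= ffunE eqxx mulr1 big1 ?addr0// => e ne.
by rewrite ffunE (negbTE ne) mulr0.
Qed.

Lemma dotpD_basis c x a i : dotp c (x + a *: basis_vec i) = dotp c x + a * c i.
Proof. by rewrite dotpDr dotpZr dotp_basis. Qed.

Lemma basis_ones i : dotp ones (basis_vec i) = 1.
Proof. by rewrite dotp_basis ffunE. Qed.

Lemma dotp_ones x : dotp ones x = mass x [set: E]%SET.
Proof.
by apply: eq_big => [e|e _]; rewrite ?inE// ffunE mul1r.
Qed.

Lemma massU x A B :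
  mass x (A :|: B)%SET = mass x A + mass x B - mass x (A :&: B)%SET.
Proof.
rewrite /mass (big_setID (A := (A :|: B)%SET) B) /=.
rewrite [((_ :|: _) :&: _)%SET]finset.setIC finset.setKU finset.setDUl.
rewrite finset.setDv finset.setU0.
by rewrite (big_setID (A := A) B) /=; ring.
Qed.

Lemma mass0 x : mass x finset.set0 = 0.
Proof. exact: big_set0. Qed.

Lemma massv0 A : mass 0 A = 0.
Proof. by apply: big1 => e _; rewrite ffunE. Qed.

Lemma massDZ x a y A : mass (x + a *: y) A = mass x A + a * mass y A.
Proof.
by rewrite /mass mulr_sumr -big_split; apply: eq_bigr => e _; rewrite !ffunE.
Qed.

Lemma mass_basis i A : mass (basis_vec i) A = (i \in A)%:R.
Proof.
rewrite /mass; case: (boolP (i \in A)) => iA.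
  rewrite (bigD1 i)//= ffunE eqxx big1 ?addr0// => e /andP[_ ne].
  by rewrite ffunE (negbTE ne).
by apply: big1 => e eA; rewrite ffunE; case: eqP => // ei; rewrite -ei eA in iA.
Qed.

Lemma mass_le x A B :
  (forall e, 0 <= x e) -> A \subset B -> mass x A <= mass x B.
Proof.
move=> x0 /finset.setIidPr AB.
by rewrite /mass (big_setID (A := B) A)/= AB lerDl sumr_ge0.
Qed.

Lemma mass_supp x A B :
  A \subset B -> (forall e, e \in B -> e \notin A -> x e = 0) ->
  mass x B = mass x A.
Proof.
move=> /finset.setIidPr AB x0.
rewrite /mass (big_setID (A := B) A)/= AB [X in _ + X]big1 ?addr0// => e.
by rewrite finset.in_setD => /andP[eA eB]; apply: x0.
Qed.

Lemma mass_le_supp x A B :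
  (forall e, 0 <= x e) -> (forall e, e \in A -> e \notin B -> x e = 0) ->
  mass x A <= mass x B.
Proof.
move=> x0 xAB; rewrite (@mass_supp x (A :&: B) A) ?finset.subsetIl//.
  by rewrite mass_le// finset.subsetIr.
by move=> e eA; rewrite finset.in_setI eA /= => /(xAB _ eA).
Qed.

Lemma massU1 x i A : i \notin A -> mass x (i |: A)%SET = x i + mass x A.
Proof. by move=> iA; rewrite /mass big_setU1. Qed.

End LinearForms.

(** * Tight sets of a polymatroid *)

Section TightSets.
Context {R : realType} {E : finType} (f : {set E} -> R) (hf : polymatroid f).
Local Notation V := {ffun E -> R}.
Local Notation P := (polymatroid_polytope f).
Implicit Types (c w x y u v : V) (A B : {set E}) (i j e : E).

Definition tight x A : bool := mass x A == f A.

(** At a point of the polytope this is the largest tight set, by [span_tight]. Its complement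
    consists of the coordinates that can be increased inside the polytope, by [raise] and
    [raise_span]. *)
Definition tspan x : {set E} := (\bigcup_(A : {set E} | tight x A) A)%SET.

Lemma poly_ge0 x e : P x -> 0 <= x e.
Proof. by case=> x0 _; apply: x0. Qed.

Lemma poly_le x A : P x -> mass x A <= f A. Proof. by case=> _; apply. Qed.

Lemma rank_mono A B : A \subset B -> f A <= f B.
Proof.
case: hf => _ _ + /finset.setUidPr AB => /(_ A B)[+ _].
by rewrite AB.
Qed.

Lemma submodular A B : f (A :|: B)%SET + f (A :&: B)%SET <= f A + f B.
Proof. by case: hf => _ _ /(_ A B)[_]; rewrite lerBrDr. Qed.

(** Uncrossing: [mass x] is modular and [f] submodular, so equality on [A] and [B] together with the
    bound on [A :&: B] forces equality on the union. *)
Lemma tightU x A B : P x -> tight x A -> tight x B -> tight x (A :|: B)%SET.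
Proof.
move=> Px /eqP tA /eqP tB; apply/eqP/le_anti; rewrite poly_le//= massU tA tB.
by rewrite lerBrDr (le_trans _ (submodular A B))// lerD2l poly_le.
Qed.

Lemma span_tight x : P x -> mass x (tspan x) = f (tspan x).
Proof.
move=> Px; apply/eqP; rewrite -/(tight _ _) /tspan.
elim/big_ind: _ => [|A B tA tB|//]; last exact: tightU.
by case: hf => _ f0 _; rewrite /tight mass0 f0.
Qed.

Lemma tight_sub_span x A : tight x A -> A \subset tspan x.
Proof. by move=> tA; apply: (finset.bigcup_sup A). Qed.

Lemma mem_span x A i : tight x A -> i \in A -> i \in tspan x.
Proof. by move=> /tight_sub_span/fintype.subsetP; apply. Qed.

Lemma span_le x A : P x -> (forall e, x e != 0 -> e \in A) -> f (tspan x) <= f A.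
Proof.
move=> Px sA; rewrite -span_tight// (le_trans _ (poly_le A Px))//.
apply: mass_le_supp => [e|e _ eA]; first exact: poly_ge0.
by apply: contraNeq eA; apply: sA.
Qed.

(** The chain [f A <= f (tspan x) = mass x (tspan x) <= mass x A] closes up, its last step because
    [x] vanishes off [A]. *)
Lemma tight_of_span x A : P x -> (forall e, x e != 0 -> e \in A) ->
  A \subset tspan x -> mass x A = f A.
Proof.
move=> Px sA As; apply/le_anti; rewrite poly_le//=.
rewrite (le_trans (rank_mono As))// -span_tight// mass_le_supp// => e.
  exact: poly_ge0.
by move=> _; apply: contraNeq => /sA.
Qed.

Lemma poly0 : P 0.
Proof.
split=> [e|A]; first by rewrite ffunE.
by rewrite big1 => [|e _]; rewrite ?ffunE//; case: hf.
Qed.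

Lemma lower_closed x y :
  P x -> (forall e, 0 <= y e <= x e) -> P y.
Proof.
move=> Px yx; split=> [e|A]; first by case/andP: (yx e).
by apply: le_trans (poly_le A Px); apply: ler_sum => e _; case/andP: (yx e).
Qed.

Lemma exchangeE x a i e : (x + a *: basis_vec i) e = x e + a * (e == i)%:R.
Proof. by rewrite !ffunE. Qed.

Lemma raise x i : P x -> i \notin tspan x ->
  exists2 a, 0 < a &
    P (x + a *: basis_vec i) /\ i \in tspan (x + a *: basis_vec i).
Proof.
move=> Px isp; have iset : i \in [set i]%SET by rewrite inE.
pose a A := f A - mass x A.
(* The step is the least slack over the sets containing [i]: positive because none of them is tight,
   admissible by minimality, and turning the minimiser into a tight set. *)
case: (@arg_minP _ _ _ [set i]%SET (fun A : {set E} => i \in A) a iset) => A iA minA.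
have a0 : 0 < a A.
  rewrite subr_gt0 lt_neqAle poly_le// andbT.
  by apply: contraNneq isp => /eqP/mem_span; apply.
exists (a A) => //; split; last first.
  by apply: (@mem_span _ A) => //; rewrite /tight massDZ mass_basis iA mulr1 subrKC.
split=> [e|B]; first by rewrite exchangeE addr_ge0 ?poly_ge0// mulr_ge0// ltW.
rewrite -/(mass _ _) massDZ mass_basis; case: (boolP (i \in B)) => iB.
  by rewrite mulr1 -lerBrDl minA.
by rewrite mulr0 addr0 poly_le.
Qed.

Lemma raise_between x i a b : P x -> P (x + b *: basis_vec i) ->
  0 <= a <= b -> P (x + a *: basis_vec i).
Proof.
move=> Px Pb /andP[a0 ab]; apply: (lower_closed Pb) => e.
rewrite !exchangeE addr_ge0 ?poly_ge0 ?mulr_ge0//=.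
by rewrite lerD2l ler_wpM2r.
Qed.

Lemma lower_coord x i : P x -> P (x + (- x i) *: basis_vec i).
Proof.
move=> Px; apply: (lower_closed Px) => e; rewrite exchangeE.
have := poly_ge0 e Px; case: eqP => [->|_] x0.
  by rewrite mulr1 subrr lexx.
by rewrite mulr0 addr0 x0 lexx.
Qed.

Lemma raise_span x i a : P x -> P (x + a *: basis_vec i) -> i \in tspan x -> a <= 0.
Proof.
move=> Px /(poly_le (tspan x)); rewrite massDZ mass_basis span_tight// => + isp.
by rewrite isp mulr1 gerDl.
Qed.

Lemma span_raise x i a : P x -> P (x + a *: basis_vec i) -> 0 <= a ->
  tspan x \subset tspan (x + a *: basis_vec i).
Proof.
move=> Px Pa a0; apply: tight_sub_span; rewrite /tight eq_le poly_le//=.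
by rewrite massDZ mass_basis -span_tight// lerDl mulr_ge0.
Qed.

(* Zeroing the weight of i makes the whole ray from v in direction i optimal,
   since v already maximises w and x - x_i e_i stays in the polytope. *)
Lemma argmax_ray w v i : argmax P w = [set v]%classic -> v i = 0 ->
  argmax P (w + (- w i) *: basis_vec i) =
  [set x | P x /\ exists2 a, 0 <= a & x = v + a *: basis_vec i]%classic.
Proof.
move=> wv vi0; have [Pv vmax] : argmax P w v by rewrite wv.
set w' := w + _.
have w'E x : dotp w' x = dotp w (x + (- x i) *: basis_vec i).
  by rewrite dotpC !dotpD_basis [dotp x w]dotpC; congr (_ + _); ring.
have w'v : dotp w' v = dotp w v by rewrite w'E vi0 oppr0 scale0r addr0.
apply/seteqP; split=> [x [Px xmax]|x [Px [a a0 xE]]] /=.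
  split=> //; exists (x i); first exact: poly_ge0.
  suff <- : x + (- x i) *: basis_vec i = v by rewrite scaleNr subrK.
  suff : argmax P w (x + (- x i) *: basis_vec i) by rewrite wv.
  split=> [|y Py]; first exact: lower_coord.
  by rewrite -w'E (le_trans (vmax _ Py))// -w'v xmax.
split=> // y Py; suff -> : dotp w' x = dotp w v.
  by rewrite w'E vmax//; apply: lower_coord.
have xi : x i = a by rewrite xE exchangeE eqxx mulr1 vi0 add0r.
by rewrite w'E xi xE scaleNr addrK.
Qed.

End TightSets.

(** Finitely many slacks [a] leave room for a positive step whose rates [b] use up no slack that is
    already zero. This provides the small step in [vertex_eq]. *)
Lemma small_step (R : realType) (I : finType) (a b : I -> R) :
  (forall i, 0 <= a i) -> (forall i, a i = 0 -> b i <= 0) ->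
  exists2 d, 0 < d & forall i, d * b i <= a i.
Proof.
(* The summand 1 keeps [s] positive. An index with [a i = 0] contributes 0, as division by zero
   yields 0, and is covered by the sign of [b i]. *)
move=> a0 b0; pose s := 1 + \sum_i `|b i| / a i.
have s_ge i : `|b i| / a i <= s.
  rewrite /s (bigD1 i)//= addrCA lerDl addr_ge0// sumr_ge0// => j _.
  by rewrite divr_ge0.
have s0 : 0 < s by rewrite ltr_wpDr// sumr_ge0// => j _; rewrite divr_ge0.
exists s^-1 => [|i]; first by rewrite invr_gt0.
rewrite mulrC ler_pdivrMr//; have [ai|ai] := eqVneq (a i) 0.
  by rewrite ai mul0r b0.
rewrite mulrC -ler_pdivrMr ?lt_def ?ai ?a0//; apply: le_trans (s_ge i).
by rewrite ler_wpM2r ?invr_ge0// ler_norm.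
Qed.

(** * Vertices and improving edges of the polymatroid polytope *)

Section VerticesAndEdges.
Context {R : realType} {E : finType} (f : {set E} -> R) (hf : polymatroid f).
Local Notation V := {ffun E -> R}.
Local Notation P := (polymatroid_polytope f).
Implicit Types (c w x y u v : V) (A B : {set E}) (i j e : E).

Lemma argmax_free w v i : argmax P w v -> i \notin tspan f v -> w i <= 0.
Proof.
move=> [Pv vmax] /(raise Pv)[a a0 [Pa _]]; have := vmax _ Pa.
by rewrite dotpD_basis gerDl pmulr_rle0.
Qed.

Lemma argmax_neg w v i : argmax P w v -> w i < 0 -> v i = 0.
Proof.
move=> [Pv vmax] wi; have := vmax _ (lower_coord i Pv).
rewrite dotpD_basis gerDl mulNr oppr_le0 (nmulr_lge0 _ wi) => vi.
by apply/le_anti; rewrite vi (poly_ge0 _ Pv).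
Qed.

Lemma vertexP v : vertices P v <-> exists w, argmax P w = [set v]%classic.
Proof.
split=> [[_ [w wv]]|[w wv]]; first by exists w.
by split; [exists v | exists w].
Qed.

Lemma vertex_poly v : vertices P v -> P v.
Proof. by move=> /vertexP[w wv]; have [] : argmax P w v by rewrite wv. Qed.

(** For [w] maximised only at [v], a free index has [w i <= 0]. Equality would make the raised point
    a second maximiser, so [w i < 0], and [argmax_neg] applies. *)
Lemma vertex_free v i : vertices P v -> i \notin tspan f v -> v i = 0.
Proof.
move=> /vertexP[w wv] isp; have vw : argmax P w v by rewrite wv.
apply: (argmax_neg vw); rewrite lt_neqAle (argmax_free vw)// andbT.
apply/eqP => wi0; have [a a0 [Pa _]] := raise vw.1 isp.
have : argmax P w (v + a *: basis_vec i).
  by split=> // y Py; rewrite dotpD_basis wi0 mulr0 addr0 vw.2.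
rewrite wv => /(congr1 (fun x => x i)); rewrite exchangeE eqxx mulr1 => /eqP.
by rewrite -subr_eq0 addrAC subrr add0r gt_eqF.
Qed.

Lemma vertex0 : vertices P 0.
Proof.
apply/vertexP; exists (- ones).
have N x : dotp (- ones) x = - mass x [set: E]%SET.
  by rewrite -scaleN1r dotpC dotpZr dotpC dotp_ones mulN1r.
apply/seteqP; split=> [x [Px /(_ _ (poly0 hf))]|_ ->] /=; last first.
  split=> [|y Py]; first exact: poly0.
  by rewrite !N lerN2 massv0 sumr_ge0// => e _; apply: (poly_ge0 _ Py).
rewrite !N lerN2 massv0 => x0.
apply/ffunP => e; rewrite ffunE; apply/le_anti; rewrite (poly_ge0 _ Px) andbT.
apply: le_trans x0; rewrite -[x e]addr0 -(mass0 x) -massU1 ?inE//.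
by apply: mass_le => [i|]; rewrite ?finset.subsetT// (poly_ge0 _ Px).
Qed.

(** With [w i] reset to 0 the optimal face is the part inside the polytope of a ray from [v], by
    [argmax_ray]. It ends where [i] enters the span. *)
Lemma vertex_raise v i : vertices P v -> i \notin tspan f v ->
  exists a, [/\ 0 < a, vertices P (v + a *: basis_vec i),
    edge P (v + a *: basis_vec i) v & i \in tspan f (v + a *: basis_vec i)].
Proof.
move=> vv isp; have Pv := vertex_poly vv; have vi0 := vertex_free vv isp.
have [a a0 [Pu iu]] := raise Pv isp; exists a; set u := v + _ in Pu iu *.
have /vertexP[w /(argmax_ray)/(_ vi0)] := vv.
set w' := w + _ => w'E.
have u_w' : argmax P w' u by rewrite w'E; split=> //; exists a => //; apply: ltW.
have uE : u = v + a *: basis_vec i by [].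
split=> //; last 1 first.
- split; first by move/eqP; rewrite -subr_eq0 uE addrAC subrr add0r => /eqP
    /ffunP/(_ i); rewrite !ffunE eqxx => /eqP; rewrite [_ *: _]mulr1 gt_eqF.
  split; first by exists v; exists 1; rewrite subrr scale0r scale1r add0r ler01 lexx.
  exists w'; rewrite w'E; apply/seteqP.
  split=> [x [t [/andP[t0 t1] ->]]|x [Px [b b0 xE]]] /=.
    have -> : (1 - t) *: u + t *: v = v + ((1 - t) * a) *: basis_vec i.
      by rewrite uE scalerDr scalerA addrAC -scalerDl subrK scale1r.
    have ta : 0 <= (1 - t) * a by rewrite mulr_ge0 ?subr_ge0// ltW.
    split; last by exists ((1 - t) * a).
    by apply: (raise_between Pv Pu); rewrite ta ler_piMl ?(ltW a0)// gerBl.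
  have ba : b <= a.
    rewrite -subr_le0; apply: (raise_span hf Pu _ iu).
    by rewrite uE -addrA -scalerDl subrKC -xE.
  exists (1 - b / a); split.
    by rewrite subr_ge0 gerBl divr_ge0 ?(ltW a0)// ler_pdivrMr// mul1r ba.
  rewrite subKr uE scalerDr scalerA divfK ?gt_eqF// addrAC -scalerDl subrKC.
  by rewrite scale1r.
(* Adding the indicator of the tight set [A] isolates [u]: it attains the bound [f A], and along the
   ray [mass _ A] determines the step length because [i \in A]. *)
apply/vertexP; pose A := tspan f u; pose ind : V := [ffun e => (e \in A)%:R].
have indE x : dotp ind x = mass x A.
  rewrite /dotp /mass [RHS]big_mkcond; apply: eq_bigr => e _.
  by rewrite ffunE; case: (e \in A); rewrite ?mul1r ?mul0r.
have wE x : dotp (w' + ind) x = dotp w' x + mass x A.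
  by rewrite dotpC dotpDr ![dotp x _]dotpC indE.
have uA : mass u A = f A by apply: span_tight.
exists (w' + ind); apply/seteqP; split=> [x [Px xmax]|_ ->] /=; last first.
  split=> // y Py; rewrite !wE; apply: lerD; first exact: u_w'.2.
  by rewrite uA poly_le.
have := xmax _ Pu; rewrite !wE uA => ux.
have xA := poly_le A Px; have xw' := u_w'.2 _ Px.
have : argmax P w' x.
  split=> // y Py; apply: le_trans (u_w'.2 _ Py) _; lra.
rewrite w'E => -[_ [b b0 xE]]; rewrite xE uE; congr (_ + _ *: _).
have : mass x A = mass u A by lra.
by rewrite xE uE !massDZ mass_basis iu !mulr1 => /addrI.
Qed.

(** The edge is an optimal face that contains some [v + a *: basis_vec i] other than [v], hence it
    runs along [basis_vec i]. *)
Lemma improving_dir u v : vertices P v -> improving_neighbors P ones v u ->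
  exists i a, [/\ i \notin tspan f v, 0 < a & u = v + a *: basis_vec i].
Proof.
move=> vv [vu [_ [_ [w wE]]]]; rewrite !dotp_ones => uv.
have Pv := vertex_poly vv; have Pu := vertex_poly vu.
have v_w : argmax P w v.
  by rewrite -wE; exists 1; rewrite subrr scale0r scale1r add0r ler01 lexx.
have u_w : argmax P w u.
  by rewrite -wE; exists 0; rewrite subr0 scale0r scale1r addr0 lexx ler01.
(* Mass on the tight set [tspan f v] cannot grow from [v] to [u], so the growth of the total occurs
   at a free index. *)
have [i isp ui] : exists2 i, i \notin tspan f v & v i < u i.
  apply: contrapT => no; move: uv; rewrite ltNge => /negP; apply.
  rewrite -[[set: E]%SET](finset.setUCr (tspan f v)) !massU finset.setICr.
  rewrite !mass0 !subr0.
  rewrite lerD ?(span_tight hf)//; first exact: poly_le.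
  apply: ler_sum => e; rewrite inE => esp; rewrite leNgt; apply/negP => ue.
  by apply: no; exists e.
(* Optimality of [v] gives [w i <= 0], and a negative value would force [u i = 0] by optimality of
   [u]. *)
have wi0 : w i = 0.
  apply/le_anti; rewrite (argmax_free v_w)//= leNgt; apply/negP => wi.
  by move: ui; rewrite (argmax_neg u_w wi) ltNge (poly_ge0 _ Pv).
have [a a0 [Pa _]] := raise Pv isp.
have : argmax P w (v + a *: basis_vec i).
  by split=> // y Py; rewrite dotpD_basis wi0 mulr0 addr0 v_w.2.
rewrite -wE => -[t [/andP[t0 t1] tE]].
have {}tE : (1 - t) *: (u - v) = a *: basis_vec i.
  rewrite -[RHS](addrK v) [_ + v]addrC tE scalerBr -addrA; congr (_ + _).
  by rewrite scalerBl scale1r opprB.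
have t1' : 0 < 1 - t.
  rewrite subr_gt0 lt_neqAle t1 andbT; apply/eqP => tt.
  move: tE; rewrite tt subrr scale0r => /ffunP/(_ i).
  by rewrite !ffunE eqxx [a *: _]mulr1 => /eqP; rewrite lt_eqF.
exists i, ((1 - t)^-1 * a); split=> //; first by rewrite mulr_gt0 ?invr_gt0.
by rewrite -scalerA -tE scalerA mulVf ?gt_eqF// scale1r subrKC.
Qed.

Lemma argmax_ones v : P v -> argmax P ones v <-> tspan f v = [set: E]%SET.
Proof.
move=> Pv; split=> [[_ vmax]|sv].
  apply/eqP; rewrite -finset.subTset; apply/fintype.subsetP => i _.
  apply: contraT => /(raise Pv)[a a0 [Pa _]]; have := vmax _ Pa.
  by rewrite dotpD_basis ffunE mulr1 gerDl leNgt a0.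
split=> // y Py; rewrite !dotp_ones.
by rewrite -sv (span_tight hf)// poly_le.
Qed.

(* If x shares the tight sets and zero coordinates of the vertex v, a small
   step from v away from x stays in the polytope, which forces x = v. *)
Lemma vertex_eq v x : vertices P v -> P x ->
  (forall A, tight f v A -> tight f x A) -> (forall e, v e = 0 -> x e = 0) ->
  x = v.
Proof.
move=> vv Px tx zx; have Pv := vertex_poly vv; have /vertexP[w wv] := vv.
pose a k := match k with inl A => f A - mass v A | inr e => v e end.
pose b k := match k with inl A => mass v A - mass x A | inr e => x e - v e end.
have [||d d0 dab] := @small_step R ({set E} + E)%type a b.
- by case=> [A|e] /=; rewrite ?subr_ge0 ?poly_le// (poly_ge0 _ Pv).
- case=> [A /eqP|e /zx xe] /=; last by rewrite xe subr_le0 (poly_ge0 _ Pv).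
  rewrite subr_eq0 eq_sym => tA.
  by rewrite (eqP tA) (eqP (tx _ tA)) subrr.
have Py : P (v + d *: (v - x)).
  split=> [e|A].
    by have := dab (inr e); rewrite /= !ffunE -[d *: _]/(d * _); lra.
  have := dab (inl A); rewrite -/(mass _ A) massDZ -scaleN1r massDZ /=; lra.
apply: contrapT => xv; have : argmax P w x -> False by rewrite wv => /xv.
apply; split=> // y Py'; apply: (@le_trans _ _ (dotp w v)).
  by have [_ ->] : argmax P w v by rewrite wv.
have [_ /(_ _ Py)] : argmax P w v by rewrite wv.
by rewrite dotpDr dotpZr dotpBr gerDl pmulr_rle0// subr_le0.
Qed.

(** By [vertex_eq] a vertex is determined by its tight sets and zero coordinates, and there are
    finitely many such pairs. *)
Lemma finite_vertices : finite_set (vertices P).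
Proof.
pose g v := ([set A : {set E} | tight f v A]%SET, [set e | v e == 0]%SET).
(* A vertex with data [k]; the default 0 for unrealised data is harmless, since the vertices need
   only be covered. *)
pose h k := xget 0 [set v | vertices P v /\ g v = k]%classic.
apply: (@sub_finite_set _ _ [set h k | k in [set: {set {set E}} * {set E}]]%classic).
  move=> v vv; exists (g v) => //; rewrite /h; case: xgetP => [x _ [vx]|/(_ v)[]//].
  move=> [/finset.setP tx /finset.setP zx]; apply: vertex_eq => //.
  - exact: vertex_poly.
  - by move=> A; have := tx A; rewrite !inE => ->.
  - by move=> e /eqP ve; have := zx e; rewrite !inE ve => /eqP.
by apply: finite_image; apply: finite_finset.
Qed.

End VerticesAndEdges.

(** * Greedy points and paths *)

Section Greedy.
Context {R : realType} {E : finType} (f : {set E} -> R) (hf : polymatroid f).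
Local Notation V := {ffun E -> R}.
Local Notation P := (polymatroid_polytope f).
Implicit Types (c w x y z u v : V) (A B : {set E}) (i j e : E) (gamma : R -> V).

(** The inequality is strict so that [above w (w j)] omits [j] and every index tied with it. *)
Definition above w (t : R) : {set E} := [set e | t < w e]%SET.

(** Summation by parts: the sum is a positive combination of masses of upper level sets. The
    induction peels off the least value [w m] above [a]. *)
Lemma abel_summation w z a :
  (forall t, a <= t -> 0 <= mass z (above w t)) ->
  0 <= \sum_(e in above w a) (w e - a) * z e /\
  (\sum_(e in above w a) (w e - a) * z e = 0 ->
   forall t, a <= t -> mass z (above w t) = 0).
Proof.
have [n] := ubnP #|above w a|; elim: n a => // n IH a leAn z0.
have [/eqP A0|[e0 e0A]] := set_0Vmem (above w a).
  rewrite (eqP A0) big_set0; split=> // _ t at_.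
  rewrite (_ : above w t = finset.set0) ?mass0//.
  apply/eqP; rewrite -finset.subset0 -(eqP A0); apply/fintype.subsetP => e.
  by rewrite !inE; apply: le_lt_trans.
case: (@arg_minP _ _ _ e0 (fun e => e \in above w a) w e0A) => m mA mmin.
have am : a < w m by move: mA; rewrite inE.
have [||IH0 IH1] := IH (w m).
- rewrite -ltnS; apply: leq_trans leAn; rewrite ltnS; apply: proper_card.
  apply/properP; split; last by exists m => //; rewrite inE ltxx.
  by apply/fintype.subsetP => e; rewrite !inE; apply: lt_trans.
- by move=> t /(le_trans (ltW am)); apply: z0.
have sumE : \sum_(e in above w a) (w e - a) * z e =
    \sum_(e in above w (w m)) (w e - w m) * z e + (w m - a) * mass z (above w a).
  rewrite /mass mulr_sumr big_mkcond [X in _ = X + _]big_mkcond /=.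
  rewrite [X in _ = _ + X]big_mkcond -big_split /=; apply: eq_bigr => e _.
  rewrite !inE; case: (ltP a (w e)) => awe; last first.
    by rewrite ltNge (le_trans awe (ltW am)) addr0.
  have wme : w m <= w e by apply: mmin; rewrite inE.
  case: (ltP (w m) (w e)) => wem; first ring.
  by rewrite (le_anti (introT andP (conj wem wme))) add0r.
have za := z0 _ (lexx a); have ma : 0 < w m - a by rewrite subr_gt0.
rewrite sumE; split; first by rewrite addr_ge0// mulr_ge0// ltW.
move/eqP; rewrite paddr_eq0// ?mulr_ge0// ?(ltW ma)// mulf_eq0 (gt_eqF ma) /=.
move=> /andP[/eqP/IH1 IHt /eqP za0] t at_; case: (leP (w m) t) => [/IHt//|tm].
(* No value of [w] lies strictly between [a] and [w m], so the level set at [t] is the one at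
   [a]. *)
rewrite -za0; congr (mass z _); apply/finset.setP => e; rewrite !inE.
apply/idP/idP => [|ae]; first exact: le_lt_trans.
by apply: lt_le_trans tm _; apply: mmin; rewrite inE.
Qed.

(* Every upper level set of w carries as much mass as the level 1(x) allows. *)
Definition greedy w x := forall t,
  f (above w t) <= mass x (above w t) \/ forall e, w e <= t -> x e = 0.

(** Supplies a base level at which Abel summation runs over all of [E]. *)
Lemma above_all w : exists a, above w a = [set: E]%SET.
Proof.
exists (- \sum_e `|w e| - 1); apply/finset.setP => e; rewrite !inE.
have : - w e <= \sum_e `|w e|.
  rewrite (bigD1 e)//= (le_trans (ler_norm _))// normrN lerDl sumr_ge0//.
lra.
Qed.

(** Either the level set is saturated by [x], or it carries the whole mass of [x], which equals that
    of [y]. *)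
Lemma greedy_level_ge w x y t : P x -> greedy w x -> P y ->
  dotp ones y = dotp ones x -> mass y (above w t) <= mass x (above w t).
Proof.
move=> Px gx Py; rewrite !dotp_ones => yx; have [fx|x0] := gx t.
  by apply: le_trans fx; apply: poly_le.
rewrite -(@mass_supp _ _ x _ [set: E]%SET) ?finset.subsetT//.
  rewrite -yx; apply: mass_le; last exact: finset.subsetT.
  by move=> e; apply: (poly_ge0 _ Py).
by move=> e _; rewrite inE -leNgt; apply: x0.
Qed.

Lemma greedy_abel w x y : P x -> greedy w x -> P y ->
  dotp ones y = dotp ones x ->
  0 <= dotp w x - dotp w y /\ (dotp w x - dotp w y = 0 ->
    forall t, mass y (above w t) = mass x (above w t)).
Proof.
move=> Px gx Py yx; have [a aE] := above_all w.
have massE t : mass (x - y) (above w t) = mass x (above w t) - mass y (above w t).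
  by rewrite -scaleN1r massDZ mulN1r.
have le_t t : 0 <= mass (x - y) (above w t).
  by rewrite massE subr_ge0 greedy_level_ge.
(* The shift by [a] drops out because [x - y] has total mass 0. *)
have wE : \sum_(e in above w a) (w e - a) * (x - y) e = dotp w x - dotp w y.
  rewrite aE -dotpBr; transitivity (dotp w (x - y) - a * dotp ones (x - y)).
    rewrite /dotp mulr_sumr -sumrB; apply: eq_big => [e|e _]; first by rewrite inE.
    by rewrite [ones e]ffunE; ring.
  by rewrite (dotpBr ones) yx subrr mulr0 subr0.
have := abel_summation (fun t _ => le_t t) (a := a); rewrite wE => -[-> abel0].
split=> // /abel0 {}abel0 t; have [ta|at_] := leP a t.
  by apply/esym/eqP; rewrite -subr_eq0 -massE abel0.
have -> : above w t = above w a.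
  apply/eqP; rewrite finset.eqEsubset aE finset.subsetT -aE.
  by apply/fintype.subsetP => e; rewrite !inE; apply: lt_trans.
by apply/esym/eqP; rewrite -subr_eq0 -massE abel0.
Qed.

Lemma greedy_max w x y : P x -> greedy w x -> P y ->
  dotp ones y = dotp ones x -> dotp w y <= dotp w x.
Proof.
by move=> Px gx Py yx; have [+ _] := greedy_abel Px gx Py yx; rewrite subr_ge0.
Qed.

(** Equality in Abel summation makes all level set masses of [x] and [y] agree, and both
    alternatives of [greedy] transfer, the second one by nonnegativity of [y]. *)
Lemma max_greedy w x y : P x -> greedy w x -> P y ->
  dotp ones y = dotp ones x -> dotp w y = dotp w x -> greedy w y.
Proof.
move=> Px gx Py yx wyx; have [_] := greedy_abel Px gx Py yx.
rewrite wyx subrr => /(_ erefl) yE t.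
have [fx|x0] := gx t; [left|right]; first by rewrite yE.
have : mass y [set: E]%SET = mass y (above w t).
  rewrite yE -dotp_ones yx dotp_ones; apply: mass_supp; rewrite ?finset.subsetT//.
  by move=> e _; rewrite inE -leNgt; apply: x0.
rewrite -(finset.setUCr (above w t)) massU finset.setICr mass0 subr0.
move=> /eqP; rewrite -subr_eq0 addrAC subrr add0r psumr_eq0 => [|e _].
  move=> /allP y0 e we; have := y0 e (mem_index_enum e).
  by rewrite !inE -leNgt we => /eqP.
exact: (poly_ge0 _ Py).
Qed.

(** The critical case is [v] supported in the level set at [t] with [w j <= t]. Every free index
    then has weight at most [t], so the level set lies in the span and is tight. *)
Lemma greedy_raise w v j a : P v -> greedy w v -> 0 <= a ->
  (forall k, k \notin tspan f v -> w k <= w j) ->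
  greedy w (v + a *: basis_vec j).
Proof.
move=> Pv gv a0 jmax t; rewrite massDZ mass_basis.
have [fv|v0] := gv t.
  by left; rewrite (le_trans fv)// lerDl mulr_ge0.
have [wj|wj] := ltP t (w j); [right|left].
  move=> e we; rewrite exchangeE v0// add0r.
  by case: eqP => [ej|_]; rewrite ?mulr0//; move: we; rewrite ej leNgt wj.
rewrite inE ltNge wj mulr0 addr0 (tight_of_span hf Pv)// => [e|].
  by rewrite inE; apply: contraNT; rewrite -leNgt => /v0/eqP.
apply/fintype.subsetP => e; rewrite inE; apply: contraTT => /jmax ej.
by rewrite -leNgt (le_trans ej).
Qed.

(** The parameter is the value of [ones]. Continuity is asked on the whole line, though only
    parameters up to [dotp ones v] are otherwise constrained, so that pieces can be glued by a
    formula. *)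
Definition greedy_path w v gamma :=
  [/\ forall e, continuous (fun s => gamma s e),
      forall s, 0 <= s <= dotp ones v ->
        [/\ P (gamma s), dotp ones (gamma s) = s & greedy w (gamma s)]
    & gamma (dotp ones v) = v].

Lemma greedy_path0 w : greedy_path w 0 (fun=> 0).
Proof.
have d0 : dotp ones (0 : V) = 0 by rewrite dotp_ones massv0.
split=> // [e s|s]; first exact: cst_continuous.
rewrite d0 => s0; split; first exact: poly0.
  exact: le_anti.
by move=> t; right=> e _; rewrite ffunE.
Qed.

Lemma greedy_path_raise w v gamma j a :
  P v -> greedy_path w v gamma -> P (v + a *: basis_vec j) -> 0 <= a ->
  (forall k, k \notin tspan f v -> w k <= w j) ->
  exists gamma', [/\ greedy_path w (v + a *: basis_vec j) gamma',
    forall s, s <= dotp ones v -> gamma' s = gamma s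
    & forall s, 0 <= s -> gamma' (dotp ones v + s) = v + s *: basis_vec j].
Proof.
set L := dotp ones v => Pv [gc gP gL] Pa a0 jmax.
have L0 : 0 <= L.
  by rewrite /L dotp_ones sumr_ge0// => e _; apply: (poly_ge0 _ Pv).
(* The minimum freezes the old path at its end and the maximum starts the new piece there, so
   continuity needs no case distinction. *)
pose gamma' s := gamma (Num.min s L) + Num.max (s - L) 0 *: basis_vec j.
have lo s : s <= L -> gamma' s = gamma s.
  move=> sL; rewrite /gamma' (min_idPl sL) (max_idPr _) ?subr_le0//.
  by rewrite scale0r addr0.
have hi s : 0 <= s -> gamma' (L + s) = v + s *: basis_vec j.
  move=> s0; rewrite /gamma' (min_idPr _) ?lerDl// [L + s]addrC addrK.
  by rewrite (max_idPl s0) gL.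
have L' : dotp ones (v + a *: basis_vec j) = L + a.
  by rewrite dotpD_basis ffunE mulr1.
exists gamma'; split=> //; split=> [e|s|].
- have -> : (fun s => gamma' s e) = (fun s => gamma (Num.min s L) e +
      Num.max (s - L) 0 * basis_vec j e).
    by apply/funext => s; rewrite /gamma' !ffunE.
  move=> s; apply: cvgD; last first.
    apply: cvgMl; apply: (@continuous_max R R (fun s => s - L) (fun=> 0)).
      by apply: cvgB; [exact: cvg_id | exact: cvg_cst].
    exact: cvg_cst.
  apply: (@continuous_comp _ _ _ (fun s => Num.min s L) (fun s => gamma s e)).
    by apply: continuous_min; [exact: cvg_id | exact: cvg_cst].
  exact: gc.
- rewrite L' => /andP[s0 sL]; have [sL'|Ls] := leP s L.
    by rewrite lo//; apply: gP; rewrite s0.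
  have sL0 : 0 <= s - L by rewrite subr_ge0 ltW.
  rewrite -[s](subrKC L) hi// dotpD_basis ffunE mulr1; split=> //.
    by apply: (raise_between Pv Pa); rewrite sL0 lerBlDl.
  apply: greedy_raise => //; rewrite -gL.
  by have [] := gP L; rewrite ?L0 ?lexx.
- by rewrite L' hi.
Qed.

Lemma exists_max_free w v i : i \notin tspan f v ->
  exists2 j, j \notin tspan f v & forall k, k \notin tspan f v -> w k <= w j.
Proof.
move=> isp; case: (@arg_maxP _ _ _ i (fun i => i \notin tspan f v) w isp) => j.
by exists j.
Qed.

(** The number of free coordinates is the induction measure for extending greedy paths. *)
Lemma free_raise_ltn v i a : P v -> P (v + a *: basis_vec i) -> 0 <= a ->
  i \notin tspan f v -> i \in tspan f (v + a *: basis_vec i) ->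
  (#|~: tspan f (v + a *: basis_vec i)%R| < #|~: tspan f v|)%N.
Proof.
move=> Pv Pa a0 isp ia; apply: proper_card; rewrite properC; apply/properP.
by split; [exact: span_raise | exists i].
Qed.

(** Free coordinates of largest weight are raised until none is left. Keeping the initial piece
    allows a first step to be prescribed in [MPP_refines]. *)
Lemma greedy_path_complete w v gamma : P v -> greedy_path w v gamma ->
  exists u gamma', [/\ greedy_path w u gamma', P u,
    tspan f u = [set: E]%SET & forall s, s <= dotp ones v -> gamma' s = gamma s].
Proof.
have [n] := ubnP #|~: tspan f v|%SET; elim: n v gamma => // n IH v gamma sn Pv gv.
have [sT|[i]] := set_0Vmem (~: tspan f v)%SET.
  by exists v, gamma; split=> //; rewrite -[LHS]finset.setCK sT finset.setC0.
rewrite inE => /(exists_max_free w)[j jsp jmax].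
have [a a0 [Pa ja]] := raise Pv jsp.
have [gamma' [ga lo _]] := greedy_path_raise Pv gv Pa (ltW a0) jmax.
have sa : (#|~: tspan f (v + a *: basis_vec j)%R| < n)%N.
  by rewrite -ltnS (leq_trans _ sn)// ltnS free_raise_ltn// ltW.
have [u [gamma'' [gu Pu su lo']]] := IH _ _ sa Pa ga.
exists u, gamma''; split=> // s sv; rewrite lo' ?lo//.
by rewrite dotpD_basis ffunE mulr1 (le_trans sv)// lerDl ltW.
Qed.

(** The greedy path from 0 is stopped once no free index has weight above [a]. The span of the
    vertex reached has the same rank as [above w a]. *)
Lemma reach_level w a : exists v gamma, [/\ vertices P v, greedy_path w v gamma,
  forall e, v e != 0 -> e \in above w a & above w a \subset tspan f v].
Proof.
suff H n v gamma : (#|~: tspan f v| < n)%N -> vertices P v ->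
    greedy_path w v gamma -> (forall e, v e != 0 -> e \in above w a) ->
    exists v gamma, [/\ vertices P v, greedy_path w v gamma,
      forall e, v e != 0 -> e \in above w a & above w a \subset tspan f v].
  apply: (H _ _ _ (ltnSn _) (vertex0 hf) (greedy_path0 w)) => e.
  by rewrite ffunE eqxx.
elim: n v gamma => // n IH v gamma sn vv gv suppv.
have Pv := vertex_poly vv.
have [av|/fintype.subsetPn[i ia isp]] := boolP (above w a \subset tspan f v).
  by exists v, gamma.
have [j jsp jmax] := exists_max_free w isp.
have [b [b0 vb _ jb]] := vertex_raise hf vv jsp; have Pb := vertex_poly vb.
have [gamma' [ga _ _]] := greedy_path_raise Pv gv Pb (ltW b0) jmax.
have sb : (#|~: tspan f (v + b *: basis_vec j)%R| < n)%N.
  by rewrite -ltnS (leq_trans _ sn)// ltnS free_raise_ltn// ltW.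
apply: (IH _ _ sb vb ga) => e.
rewrite exchangeE; case: (eqVneq e j) => [-> _|_]; last by rewrite mulr0 addr0 => /suppv.
by move: ia; rewrite !inE => /lt_le_trans; apply; apply: jmax.
Qed.

End Greedy.

(** * Integrals of continuous functions on a compact interval *)

Section IntervalIntegral.
Context {R : realType}.
Implicit Types (a b : R) (g : R -> R).
Local Notation mu := (@lebesgue_measure R).

Lemma within_integrable a b g :
  {within `[a, b], continuous g}%classic ->
  mu.-integrable `[a, b]%classic (EFin \o g).
Proof. by apply: continuous_compact_integrable; exact: segment_compact. Qed.

Lemma Rintegral_ge_sub a b p q g c : {within `[a, b], continuous g}%classic ->
  (forall x, x \in `[a, b] -> 0 <= g x) -> a <= p -> p <= q -> q <= b ->
  (forall x, x \in `[p, q] -> c <= g x) ->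
  c * (q - p) <= \int[mu]_(x in `[a, b]) g x.
Proof.
move=> gc g0 ap pq qb cg.
have sub : (`[p, q] `<=` `[a, b])%classic.
  move=> x /=; rewrite !in_itv /= => /andP[px xq].
  by rewrite (le_trans ap)//= (le_trans xq).
have gi := within_integrable gc.
have gi' : mu.-integrable `[p, q]%classic (EFin \o g).
  exact: integrableS gi.
have -> : c * (q - p) = \int[mu]_(x in `[p, q]) (cst c x).
  rewrite Rintegral_cst//= lebesgue_measure_itv /= lte_fin lt_neqAle pq andbT.
  by case: eqVneq => [->|_]; rewrite ?subrr ?mulr0.
apply: (@le_trans _ _ (\int[mu]_(x in `[p, q]) g x)).
  apply: le_Rintegral => //; apply: within_integrable.
  by apply: continuous_subspaceT => x; exact: cst_continuous.
rewrite /Rintegral fine_le ?integrable_fin_num//.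
apply: ge0_subset_integral => //.
  by case/integrableP: gi.
Qed.

Lemma Rintegral_eq0 a b g : a < b -> {within `[a, b], continuous g}%classic ->
  (forall x, x \in `[a, b] -> 0 <= g x) ->
  \int[mu]_(x in `[a, b]) g x = 0 -> forall x, x \in `[a, b] -> g x = 0.
Proof.
move=> ab gc g0 int0 x xab; apply/le_anti; rewrite (g0 x xab) andbT leNgt.
apply/negP => gx; move/subspace_continuousP : (gc) => /(_ x xab).
move/cvgrPdist_lt => /(_ (g x / 2)); rewrite divr_gt0// => /(_ isT).
rewrite near_withinE => /nbhs_ballP[d /= d0 dg].
have /andP[ax xb] : a <= x <= b by rewrite in_itv in xab.
(* Halving [d] puts the closed interval inside the open ball; clipping to [[a, b]] leaves positive
   length even when [x] is an endpoint. *)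
pose p := Num.max a (x - d / 2); pose q := Num.min b (x + d / 2).
have pq : p < q.
  rewrite /p /q gt_max !lt_min ab /=; apply/andP; split; first by lra.
  by apply/andP; split; lra.
have : g x / 2 * (q - p) <= \int[mu]_(x in `[a, b]) g x.
  apply: Rintegral_ge_sub => //; rewrite ?le_max ?ge_min ?lexx ?(ltW pq)// => y.
  rewrite in_itv /= ge_max le_min => /andP[/andP[ay xy] /andP[yb yx]].
  have /dg : ball x d y by rewrite /ball /= ltr_norml; apply/andP; split; lra.
  rewrite /= in_itv /= ay yb => /(_ isT); rewrite ltr_norml /from_subspace.
  by move=> /andP[_]; lra.
by rewrite int0 leNgt mulr_gt0 ?subr_gt0// divr_gt0.
Qed.

End IntervalIntegral.

(** * Linear forms and coordinatewise integrals *)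

Section IntegralForm.
Context {R : realType} {E : finType}.
Local Notation V := {ffun E -> R}.
Implicit Types (w : V) (gamma : R -> V).

Lemma within_dotp w gamma a b :
  (forall e, {within `[a, b], continuous (fun s => gamma s e)}%classic) ->
  {within `[a, b], continuous (fun s => dotp w (gamma s))}%classic.
Proof.
move=> gc s; apply: cvg_big => [|e _]; first exact: add_continuous.
by apply: cvgMr; exact: gc.
Qed.

Lemma dotp_Rintegral w gamma a b :
  (forall e, {within `[a, b], continuous (fun s => gamma s e)}%classic) ->
  dotp w [ffun e => \int[lebesgue_measure]_(s in `[a, b]) gamma s e] =
  \int[lebesgue_measure]_(s in `[a, b]) dotp w (gamma s).
Proof.
move=> gc; rewrite /dotp.
(* Integrability of the partial sums is carried through the induction because additivity of the
   integral requires it. *)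
have H (r : seq E) : lebesgue_measure.-integrable `[a, b]%classic
      (EFin \o (fun s => \sum_(e <- r) w e * gamma s e)) /\
    \int[lebesgue_measure]_(s in `[a, b]) (\sum_(e <- r) w e * gamma s e) =
    \sum_(e <- r) w e * \int[lebesgue_measure]_(s in `[a, b]) gamma s e.
  elim: r => [|e r [Ii IE]].
    have -> : (fun s => \sum_(e <- [::]) w e * gamma s e) = cst 0.
      by apply/funext => s; rewrite big_nil.
    rewrite big_nil Rintegral_cst//= mul0r; split=> //.
    apply: within_integrable.
    by apply: continuous_subspaceT => x; exact: cst_continuous.
  have Ie : lebesgue_measure.-integrable `[a, b]%classic
      (EFin \o (fun s => w e * gamma s e)).
    by apply: within_integrable => s; apply: cvgMr; exact: gc.
  have -> : (fun s => \sum_(e <- e :: r) w e * gamma s e) =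
      (fun s => w e * gamma s e + \sum_(e <- r) w e * gamma s e).
    by apply/funext => s; rewrite big_cons.
  split; first exact: (integrableD _ Ie Ii).
  rewrite RintegralD// IE big_cons RintegralZl//.
  by apply: within_integrable; exact: gc.
by rewrite (H _).2; apply: eq_bigr => e _; rewrite ffunE.
Qed.

End IntegralForm.

(** * Faces of the monotone path polytope *)

Section MonotonePathPolytope.
Context {R : realType} {E : finType} (f : {set E} -> R) (hf : polymatroid f).
Context (hE : 0 < f [set: E]%SET).
Local Notation V := {ffun E -> R}.
Local Notation P := (polymatroid_polytope f).
Implicit Types (c w x y z u v : V) (A B : {set E}) (i j e : E) (gamma : R -> V).

(** Empty when [tspan f v] is everything, so maximisers of [ones] impose no condition in
    [refines_steepest]. *)
Definition steepest w v : {set E} :=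
  [set j | (j \notin tspan f v) &&
           [forall k, (k \notin tspan f v) ==> (w k <= w j)]]%SET.

Definition refines_steepest w w' := forall v, vertices P v ->
  steepest w v \subset steepest w' v.

Lemma steepestP w v j : reflect (j \notin tspan f v /\
  forall k, k \notin tspan f v -> w k <= w j) (j \in steepest w v).
Proof.
rewrite inE; apply: (iffP andP) => -[jv jmax]; split=> //.
  by move=> k; apply/implyP; move/forallP: jmax => ->.
by apply/forallP => k; apply/implyP; apply: jmax.
Qed.

Lemma complete_path_section w u gamma : greedy_path f w u gamma -> P u ->
  tspan f u = [set: E]%SET ->
  levels P ones = `[0, f [set: E]%SET]%classic /\ section P ones gamma.
Proof.
move=> [gc gP _] Pu su; have uE : dotp ones u = f [set: E]%SET.
  by rewrite dotp_ones -su span_tight.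
have lE : levels P ones = `[0, f [set: E]%SET]%classic.
  apply/seteqP; split=> [s [x Px <-]|s] /=; rewrite in_itv /=.
    rewrite dotp_ones poly_le// andbT sumr_ge0// => e _.
    exact: (poly_ge0 _ Px).
  by rewrite -uE => /gP[Ps Es _]; exists (gamma s).
split=> //; rewrite /section lE; split=> [s|s|e].
- by rewrite /= in_itv /= -uE => /gP[].
- by rewrite /= in_itv /= -uE => /gP[].
- exact: continuous_subspaceT.
Qed.

(** A complete greedy path, here for the weight 0, passes through every level. *)
Lemma levelsE : levels P ones = `[0, f [set: E]%SET]%classic.
Proof.
have [u [gamma [gu Pu su _]]] :=
  greedy_path_complete hf (poly0 hf) (greedy_path0 hf 0).
by have [] := complete_path_section gu Pu su.
Qed.

Lemma path_section w u gamma : greedy_path f w u gamma -> P u ->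
  tspan f u = [set: E]%SET ->
  section P ones gamma /\ forall s, levels P ones s -> greedy f w (gamma s).
Proof.
move=> gu Pu su; have [lE ?] := complete_path_section gu Pu su; split=> // s.
have uE : dotp ones u = f [set: E]%SET by rewrite dotp_ones -su span_tight.
by case: gu => _ gP _; rewrite lE /= in_itv /= -uE => /gP[].
Qed.

Lemma exists_greedy_section w : exists gamma,
  section P ones gamma /\ forall s, levels P ones s -> greedy f w (gamma s).
Proof.
have [u [gamma [gu Pu su _]]] :=
  greedy_path_complete hf (poly0 hf) (greedy_path0 hf w).
by exists gamma; apply: path_section gu Pu su.
Qed.

Lemma dotp_integral_section w gamma : section P ones gamma ->
  dotp w (2 *: integral_section P ones gamma) =
  2 * \int[lebesgue_measure]_(s in `[0, f [set: E]%SET]) dotp w (gamma s).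
Proof.
move=> [_ _]; rewrite levelsE => gc; rewrite dotpZr /integral_section levelsE.
by rewrite dotp_Rintegral.
Qed.

Lemma section_within w gamma : section P ones gamma ->
  {within `[0, f [set: E]%SET], continuous (fun s => dotp w (gamma s))}%classic.
Proof. by move=> [_ _]; rewrite levelsE => gc; apply: within_dotp. Qed.

Lemma greedy_section_le w gamma gamma' : section P ones gamma ->
  section P ones gamma' -> (forall s, levels P ones s -> greedy f w (gamma s)) ->
  forall s, levels P ones s -> dotp w (gamma' s) <= dotp w (gamma s).
Proof.
move=> [gP gE _] [g'P g'E _] gg s sl.
by apply: greedy_max; rewrite ?gE ?g'E//; [exact: gP | exact: gg | exact: g'P].
Qed.

(** A greedy section dominates every other section level by level, and integration preserves
    this. *)
Lemma greedy_section_argmax w gamma : section P ones gamma ->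
  (forall s, levels P ones s -> greedy f w (gamma s)) ->
  argmax (MPP P ones) w (2 *: integral_section P ones gamma).
Proof.
move=> sg gg; split; first by exists gamma.
move=> _ [gamma' [sg' ->]]; rewrite !dotp_integral_section// ler_pM2l//.
apply: le_Rintegral => //; try by apply: within_integrable; apply: section_within.
by move=> s; rewrite -levelsE; apply: greedy_section_le.
Qed.

(** Against a greedy section the loss is continuous, nonnegative and of integral 0, hence zero on
    every level; [max_greedy] then applies. *)
Lemma argmax_section_greedy w gamma : section P ones gamma ->
  argmax (MPP P ones) w (2 *: integral_section P ones gamma) ->
  forall s, levels P ones s -> greedy f w (gamma s).
Proof.
move=> sg [_ gmax]; have [gamma0 [sg0 gg0]] := exists_greedy_section w.
have intB : \int[lebesgue_measure]_(s in `[0, f [set: E]%SET])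
    (dotp w (gamma0 s) - dotp w (gamma s)) = 0.
  rewrite RintegralB//; try by apply: within_integrable; apply: section_within.
  apply/eqP; rewrite subr_eq0; apply/eqP/le_anti/andP; split.
    have /gmax : MPP P ones (2 *: integral_section P ones gamma0) by exists gamma0.
    by rewrite !dotp_integral_section// ler_pM2l.
  have [_] := greedy_section_argmax sg0 gg0.
  move=> /(_ (2 *: integral_section P ones gamma)); rewrite !dotp_integral_section//.
  by rewrite ler_pM2l//; apply; exists gamma.
move=> s sl; have [g0P g0E _] := sg0; have [gP gE _] := sg.
apply: (max_greedy (g0P _ sl) (gg0 _ sl) (gP _ sl)); first by rewrite g0E ?gE.
apply/esym/eqP; rewrite -subr_eq0; apply/eqP.
apply: (Rintegral_eq0 hE _ _ intB); last by move: sl; rewrite levelsE.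
  by move=> t; apply: cvgB; apply: section_within.
move=> t tl; rewrite subr_ge0; apply: (greedy_section_le sg0) => //.
by rewrite levelsE.
Qed.

Lemma refines_greedy w w' x : refines_steepest w w' -> P x ->
  greedy f w x -> greedy f w' x.
Proof.
move=> ww' Px gx t; set T' := above w' t.
have [fT|xT] := leP (f T') (mass x T'); [by left|right].
apply: contrapT => /existsNP[j0 /not_implyP[j0t /eqP j0x]].
have j0in : (j0 \notin T') && (x j0 != 0) by rewrite inE -leNgt j0t.
(* Among the support of [x] outside [T'], the index [j] has the largest [w]. It will be [w]-steepest
   but not [w']-steepest at a suitable vertex. *)
case: (@arg_maxP _ _ _ j0 (fun j => (j \notin T') && (x j != 0)) w j0in).
move=> j /andP[jT' xj] jmax; pose T := above w (w j).
have xj0 : 0 < x j by rewrite lt_def xj (poly_ge0 _ Px).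
have jT : j \notin T by rewrite inE ltxx.
have xT_eq : mass x T = f T.
  apply/le_anti; rewrite poly_le//=; have [//|xw] := gx (w j).
  by move: xj; rewrite xw ?eqxx.
have [v [gamma [vv gv suppv Tv]]] := reach_level hf w (w j).
have Pv := vertex_poly vv.
have fv : f (tspan f v) <= f T by apply: span_le.
(* Otherwise [j |: T] lies in the span, whose rank is at most [f T = mass x T], which leaves no room
   for [x j > 0]. *)
have jv : j \notin tspan f v.
  apply: contraTN xj0 => jv; rewrite -leNgt -(lerD2r (mass x T)) add0r.
  rewrite -(massU1 x jT) xT_eq (le_trans _ fv)// (le_trans (poly_le _ Px))//.
  apply: rank_mono => //; apply/fintype.subsetP => e; rewrite !inE.
  by case/predU1P => [->//|we]; apply: (fintype.subsetP Tv); rewrite inE.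
(* Otherwise [f T' <= f T = mass x T], and by the choice of [j] the support of [x] in [T] lies in
   [T'], contradicting [xT]. *)
have /fintype.subsetPn[i iT' iv] : ~~ (T' \subset tspan f v).
  apply: contraTN xT => T'v; rewrite -leNgt (le_trans (rank_mono hf T'v))//.
  rewrite (le_trans fv)// -xT_eq mass_le_supp// => e; first exact: (poly_ge0 _ Px).
  rewrite inE => eT eT'; apply/eqP; apply: contraTT eT => xe.
  by rewrite -leNgt; apply: jmax; rewrite eT'.
have /steepestP[_ /(_ i iv)] : j \in steepest w' v.
  apply: (fintype.subsetP (ww' v vv)); apply/steepestP; split=> // k kv.
  rewrite leNgt; apply: contraNN kv => wk; apply: (fintype.subsetP Tv).
  by rewrite inE.
move: iT' jT'; rewrite !inE -leNgt => ti jt; rewrite leNgt.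
by rewrite (le_lt_trans jt ti).
Qed.

Lemma MPP_refines w w' :
  (argmax (MPP P ones) w `<=` argmax (MPP P ones) w')%classic ->
  refines_steepest w w'.
Proof.
move=> ww' v vv; apply/fintype.subsetP => j /steepestP[jv jmax].
apply/steepestP; split=> // i iv; rewrite leNgt; apply/negP => wji.
have [x [gamma [vx gx suppx Tx]]] := reach_level hf w (w j).
have Px := vertex_poly vx; have Pv := vertex_poly vv.
have Tv : above w (w j) \subset tspan f v.
  apply/fintype.subsetP => k; rewrite inE; apply: contraTT => /jmax.
  by rewrite leNgt.
(* Since [D] has no more rank than [C :&: D], submodularity bounds [f (C :|: D)] by
   [f C = mass v C]. So [C :|: D] is tight at [v], and [D] lies in [C]. *)
have free k : k \notin tspan f v -> k \notin tspan f x.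
  apply: contraNN => kx; set C := tspan f v; set D := tspan f x in kx *.
  have fD : f D <= f (C :&: D)%SET.
    apply: le_trans (span_le hf Px suppx) _; apply: rank_mono => //.
    by rewrite finset.subsetI Tv.
  suff tU : tight f v (C :|: D)%SET by apply: (mem_span tU); rewrite inE kx orbT.
  rewrite /tight eq_le poly_le//=; apply: (@le_trans _ _ (f C)).
    by have := submodular hf C D; lra.
  rewrite -span_tight//; apply: mass_le; last exact: finset.subsetUl.
  by move=> e; apply: (poly_ge0 _ Pv).
have [a a0 [Pa _]] := raise Px (free _ jv).
have [b b0 [Pb _]] := raise Px (free _ iv).
have jmax' k : k \notin tspan f x -> w k <= w j.
  move=> kx; rewrite leNgt; apply: contraNN kx => wk.
  by apply: (fintype.subsetP Tx); rewrite inE.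
have [gamma1 [gx1 _ hi]] := greedy_path_raise hf Px gx Pa (ltW a0) jmax'.
have [u [gamma2 [gu Pu su lo]]] := greedy_path_complete hf Pa gx1.
have [s2 g2] := path_section gu Pu su.
have g2' := argmax_section_greedy s2 (ww' _ (greedy_section_argmax s2 g2)).
(* Steps of length [d] in directions [i] and [j] both stay in the polytope and reach the same level.
   The optimal section goes through the [j] one, although the [i] one has larger [w']. *)
pose d := Num.min a b; have d0 : 0 < d by rewrite lt_min a0.
have Pd k r : P (x + r *: basis_vec k) -> d <= r -> P (x + d *: basis_vec k).
  by move=> Pc dc; apply: raise_between Px Pc _; rewrite ltW.
have Pdi : P (x + d *: basis_vec i) by apply: Pd Pb _; rewrite ge_min lexx orbT.
have Pdj : P (x + d *: basis_vec j) by apply: Pd Pa _; rewrite ge_min lexx.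
have Ed k : dotp ones (x + d *: basis_vec k) = dotp ones x + d.
  by rewrite dotpD_basis ffunE mulr1.
have sE : gamma2 (dotp ones x + d) = x + d *: basis_vec j.
  rewrite lo ?hi ?(ltW d0)// dotpD_basis ffunE mulr1 lerD2l.
  by rewrite ge_min lexx.
have sl : levels P ones (dotp ones x + d) by exists (x + d *: basis_vec j).
have := g2' _ sl; rewrite sE => gj.
have := greedy_max Pdj gj Pdi; rewrite !Ed => /(_ erefl).
by rewrite !dotpD_basis lerD2l ler_pM2l// leNgt wji.
Qed.

Lemma refines_MPP w w' : refines_steepest w w' ->
  (argmax (MPP P ones) w `<=` argmax (MPP P ones) w')%classic.
Proof.
move=> ww' x xw; have [gamma [sg xE]] := xw.1; rewrite xE in xw *.
apply: greedy_section_argmax => // s sl; apply: (refines_greedy ww').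
  by case: sg => gP _ _; apply: gP.
exact: (argmax_section_greedy sg xw).
Qed.

Lemma MPP_argmax_nonempty w : (argmax (MPP P ones) w !=set0)%classic.
Proof.
have [gamma [sg gg]] := exists_greedy_section w.
by eexists; apply: greedy_section_argmax sg gg.
Qed.

End MonotonePathPolytope.

(** * Convex hulls and comparison of normal fans *)

Section Hull.
Local Open Scope classical_set_scope.
Context {R : realType} {E : finType}.
Local Notation V := {ffun E -> R}.
Implicit Types (P Q S K : set V) (w x : V).

Lemma sub_hull S : S `<=` convex_hull S.
Proof. exact: sub_smallest. Qed.

Lemma hull_min S K : (forall x y (t : R), 0 <= t <= 1 -> K x -> K y ->
  K (t *: x + (1 - t) *: y)) -> S `<=` K -> convex_hull S `<=` K.
Proof.
move=> Kc SK; apply: smallest_sub => // x y t; rewrite !inE.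
by apply: Kc; rewrite ge0 le1.
Qed.

Lemma hull_le S w h : (forall x, S x -> dotp w x <= h) ->
  forall x, convex_hull S x -> dotp w x <= h.
Proof.
move=> Sh; apply: (@hull_min _ [set x | dotp w x <= h]) => //= x y t.
by move=> /andP[t0 t1] xh yh; rewrite dotpDr !dotpZr; nra.
Qed.

Lemma argmax_hull S w : argmax S w `<=` argmax (convex_hull S) w.
Proof.
by move=> x [Sx xmax]; split; [exact: sub_hull | exact: hull_le].
Qed.

(* The points of the hull lying strictly below the w-maximum, together with
   the w-maximal ones that are also w'-maximal, already form a convex set. *)
Lemma argmax_hull_sub S w w' : argmax S w !=set0 ->
  (argmax S w `<=` argmax S w' <->
   argmax (convex_hull S) w `<=` argmax (convex_hull S) w').
Proof.
move=> [x0 x0w]; split=> sub; last first.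
  move=> x xw; have [_ xmax] := sub _ (argmax_hull xw).
  by split=> [|y Sy]; [exact: xw.1 | apply: xmax; exact: sub_hull].
have x0w' := sub _ x0w; set h := dotp w x0; set h' := dotp w' x0.
have hull_h x : convex_hull S x ->
    dotp w x < h \/ (dotp w x = h /\ dotp w' x = h').
  move: x; apply: (@hull_min _ [set x | _ \/ _]) => [x y t /andP[t0 t1] /=|x Sx /=].
    rewrite !dotpDr !dotpZr; have [->|tn0] := eqVneq t 0.
      by rewrite !mul0r !add0r subr0 !mul1r.
    have [->|tn1] := eqVneq t 1.
      by rewrite subrr !mul0r !addr0 !mul1r.
    have {tn0}t0 : 0 < t by rewrite lt_def tn0.
    have {tn1}t1 : 0 < 1 - t by rewrite subr_gt0 lt_neqAle tn1.
    move=> [xh|[xh xh']] [yh|[yh yh']]; [left|left|left|right].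
    - nra.
    - by rewrite yh; nra.
    - by rewrite xh; nra.
    - by rewrite xh yh xh' yh'; split; ring.
  have := x0w.2 _ Sx; rewrite le_eqVlt => /predU1P[xh|]; [right|by left].
  have [_ xmax] : argmax S w' x.
    by apply: sub; split=> // y Sy; rewrite xh; apply: x0w.2.
  by split=> //; apply/le_anti; rewrite xmax ?x0w'.2//; case: x0w.
move=> x [Hx xmax]; split=> // y Hy; have := hull_le x0w'.2 Hy.
have [|[_ ->]//] := hull_h x Hx.
by rewrite ltNge xmax//; case: x0w => /sub_hull.
Qed.

(** A weight [w'] lies in the normal cone of the face of [w] exactly when the face of [w] is
    contained in that of [w'], so the inclusions determine the cones. Nonemptiness makes every
    optimal set a face. *)
Lemma normal_fan_eq P Q :
  (forall w, argmax P w !=set0) -> (forall w, argmax Q w !=set0) ->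
  (forall w w', argmax P w `<=` argmax P w' <-> argmax Q w `<=` argmax Q w') ->
  normal_fan P = normal_fan Q.
Proof.
move=> P0 Q0 PQ.
have coneE w : normal_cone P (argmax P w) = normal_cone Q (argmax Q w).
  by apply/seteqP; split=> w' /PQ.
apply/seteqP; split=> C [F [[_ [w ->]] ->]].
  by exists (argmax Q w); split=> //; split=> //; exists w.
by exists (argmax P w); split=> //; split=> //; exists w.
Qed.

End Hull.

(** * Faces of the pivot polytope *)

Section PivotPolytope.
Context {R : realType} {E : finType} (f : {set E} -> R) (hf : polymatroid f).
Local Notation V := {ffun E -> R}.
Local Notation P := (polymatroid_polytope f).
Implicit Types (c w x y z u v : V) (i j e : E) (A : V -> V).

(** The vertices moved by every arborescence, described through the span so that a free index is at
    hand. *)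
Definition suboptimal : set V :=
  [set v | vertices P v /\ tspan f v <> [set: E]%SET]%classic.

Definition unit_slope A v : V := (dotp ones (A v - v))^-1 *: (A v - v).

Lemma unit_slope_dir A v i a : 0 < a -> A v = v + a *: basis_vec i ->
  unit_slope A v = basis_vec i.
Proof.
move=> a0 Av; rewrite /unit_slope Av addrAC subrr add0r dotpZr basis_ones mulr1.
by rewrite scalerA mulVf ?gt_eqF// scale1r.
Qed.

Lemma suboptimal_argmax v : vertices P v -> ~ argmax P ones v <-> suboptimal v.
Proof.
move=> vv; have maxE := argmax_ones hf (vertex_poly vv).
by split=> [nmax|[_ nT] /maxE//]; split=> // /maxE.
Qed.

Lemma arborescence_slope A v : arborescence P ones A -> suboptimal v ->
  A v <> v /\ exists2 i, i \notin tspan f v & unit_slope A v = basis_vec i.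
Proof.
move=> arb sv; have vv := sv.1; have [_] := arb v vv.
move=> /(_ ((suboptimal_argmax vv).2 sv)) imp; split.
  by move=> Av; case: imp => _ _; rewrite Av ltxx.
have [i [a [iv a0 Av]]] := improving_dir hf vv imp.
by exists i => //; apply: unit_slope_dir a0 Av.
Qed.

Lemma finite_suboptimal : finite_set suboptimal.
Proof. by apply: sub_finite_set (finite_vertices f) => v []. Qed.

Local Notation subopts := (fset_set suboptimal).

Lemma mem_subopts v : (v \in subopts) = (v \in suboptimal).
Proof. by rewrite in_fset_set//; apply: finite_suboptimal. Qed.

(** The index set is the same for all arborescences, which makes termwise comparison possible. *)
Lemma PsiE A : arborescence P ones A ->
  Psi P ones A = \sum_(v <- subopts) unit_slope A v.
Proof.
move=> arb; rewrite /Psi -fsbig_finite; last exact: finite_suboptimal.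
congr (\sum_(v \in _) _); apply/seteqP; split=> v [vv].
  move=> Av; apply/suboptimal_argmax => // vmax; apply: Av.
  by apply: (arb v vv).1.
by move=> sv; split=> //; apply: (arborescence_slope arb _).1.
Qed.

(** Choices at different vertices are independent, and by [vertex_raise] every free index gives an
    improving edge. [Q] lists the directions allowed at each vertex. *)
Lemma exists_arborescence (Q : V -> E -> Prop) :
  (forall v, suboptimal v -> exists2 i, i \notin tspan f v & Q v i) ->
  exists2 A, arborescence P ones A &
    forall v, suboptimal v -> exists2 i, Q v i & unit_slope A v = basis_vec i.
Proof.
move=> Qv; pose good v u := (argmax P ones v -> u = v) /\ (~ argmax P ones v ->
  improving_neighbors P ones v u /\
  exists i a, [/\ Q v i, 0 < a & u = v + a *: basis_vec i]).
have /choice[A Agood] : forall v, exists u, vertices P v -> good v u.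
  move=> v; have [vv|nv] := pselect (vertices P v); last by exists v => /nv.
  have [vmax|nmax] := pselect (argmax P ones v); first by exists v.
  have [i iv Qi] := Qv v ((suboptimal_argmax vv).1 nmax).
  have [a [a0 vu ed _]] := vertex_raise hf vv iv.
  exists (v + a *: basis_vec i) => _; split=> // _; split; last by exists i, a.
  by split=> //; rewrite dotpD_basis ffunE mulr1 ltrDl.
exists A => [v vv|v sv].
  by split=> [/(Agood v vv).1//|/(Agood v vv).2[]].
have [_ [i [a [Qi a0 Av]]]] := (Agood v sv.1).2 ((suboptimal_argmax sv.1).2 sv).
by exists i => //; apply: unit_slope_dir a0 Av.
Qed.

Definition steepest_arborescence w A := forall v, suboptimal v ->
  exists2 i, i \in steepest f w v & unit_slope A v = basis_vec i.

Lemma suboptimal_steepest w v : suboptimal v -> exists i, i \in steepest f w v.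
Proof.
move=> [_ /eqP]; rewrite -finset.subTset => /fintype.subsetPn[i _ iv].
by have [j jv jmax] := exists_max_free w iv; exists j; apply/steepestP.
Qed.

Lemma steepest_slope_le w A A' v : arborescence P ones A' ->
  steepest_arborescence w A -> suboptimal v ->
  dotp w (unit_slope A' v) <= dotp w (unit_slope A v).
Proof.
move=> arb' stA sv; have [i /steepestP[_ imax] ->] := stA v sv.
by have [_ [j jv ->]] := arborescence_slope arb' sv; rewrite !dotp_basis imax.
Qed.

Lemma dotp_Psi w A : arborescence P ones A ->
  dotp w (Psi P ones A) = \sum_(v <- subopts) dotp w (unit_slope A v).
Proof. by move=> arb; rewrite PsiE// dotp_sumr. Qed.

Lemma steepest_Psi_max w A A' : arborescence P ones A -> arborescence P ones A' ->
  steepest_arborescence w A ->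
  dotp w (Psi P ones A') <= dotp w (Psi P ones A).
Proof.
move=> arb arb' stA; rewrite !dotp_Psi// big_seq [leRHS]big_seq.
apply: ler_sum => v; rewrite mem_subopts inE => sv.
exact: steepest_slope_le.
Qed.

(** The termwise differences are nonnegative with sum 0, so every one of them vanishes. *)
Lemma Psi_max_steepest w A A' : arborescence P ones A -> arborescence P ones A' ->
  steepest_arborescence w A ->
  dotp w (Psi P ones A') = dotp w (Psi P ones A) -> steepest_arborescence w A'.
Proof.
move=> arb arb' stA /esym/eqP; rewrite -subr_eq0 !dotp_Psi// -sumrB big_seq.
rewrite psumr_eq0 => [/allP sum0 v sv|v]; last first.
  by rewrite mem_subopts inE subr_ge0 => sv; apply: steepest_slope_le.
have sv' : v \in subopts by rewrite mem_subopts inE.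
have := sum0 v sv'; rewrite sv' subr_eq0 => /eqP.
have [i /steepestP[_ imax] ->] := stA v sv.
have [_ [j jv ->]] := arborescence_slope arb' sv; rewrite !dotp_basis => ij.
by exists j => //; apply/steepestP; split=> // k kv; rewrite -ij imax.
Qed.

Local Notation Psis :=
  [set x | exists A, arborescence P ones A /\ x = Psi P ones A]%classic.

Lemma exists_steepest_arborescence w :
  exists2 A, arborescence P ones A & steepest_arborescence w A.
Proof.
apply: exists_arborescence => v /(suboptimal_steepest w)[i isteep].
by exists i => //; case/steepestP: isteep.
Qed.

Lemma argmax_Psis w A : arborescence P ones A ->
  argmax Psis w (Psi P ones A) <-> steepest_arborescence w A.
Proof.
move=> arb; have [A0 arb0 st0] := exists_steepest_arborescence w.
split=> [[_ Amax]|st].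
  apply: (Psi_max_steepest arb0) => //; apply/le_anti.
  by rewrite steepest_Psi_max//=; apply: Amax; exists A0.
split; first by exists A.
by move=> _ [A' [arb' ->]]; apply: steepest_Psi_max.
Qed.

Lemma argmax_Psis_nonempty w : (argmax Psis w !=set0)%classic.
Proof.
have [A arb st] := exists_steepest_arborescence w.
by exists (Psi P ones A); apply/argmax_Psis.
Qed.

Lemma argmax_Psis_refines w w' :
  (argmax Psis w `<=` argmax Psis w')%classic <-> refines_steepest f w w'.
Proof.
split=> [sub v vv|ref].
  apply/fintype.subsetP => j jst.
  (* An arborescence that is [w]-steepest everywhere and uses the given index [j] at [v]; its
     optimality for [w'] then tests [j] itself. *)
  have [A arb st] : exists2 A, arborescence P ones A &
      forall u, suboptimal u ->
      exists2 i, i \in steepest f w u /\ (u = v -> i = j) &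
        unit_slope A u = basis_vec i.
    apply: exists_arborescence => u su; have [->|uv] := pselect (u = v).
      by exists j => //; case/steepestP: jst.
    have [i ist] := suboptimal_steepest w su.
    by exists i => //; case/steepestP: ist.
  have /sub/(argmax_Psis _ arb) st' : argmax Psis w (Psi P ones A).
    by apply/argmax_Psis => // u /st[i [ist _]]; exists i.
  have sv : suboptimal v.
    split=> // vT; case/steepestP: jst; by rewrite vT inE.
  have [i [_ ->// iE]] := st v sv; have [k kst] := st' v sv.
  rewrite iE => /ffunP/(_ k); rewrite !ffunE eqxx; case: eqP => [<-//|_ /eqP].
  by rewrite eq_sym oner_eq0.
move=> x xw; have [A [arb xE]] := xw.1; rewrite xE in xw *.
apply/argmax_Psis => // v sv; have [i ist iE] := (argmax_Psis w arb).1 xw v sv.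
by exists i => //; apply: (fintype.subsetP (ref v sv.1)).
Qed.

End PivotPolytope.

Theorem theorem4p3 (R : realType) (E : finType) (f : {set E} -> R)
  (hf : polymatroid f) (hE : 0 < f [set: E]%SET) :
  normally_equivalent (MPP (polymatroid_polytope f) ones)
                      (pivot_polytope (polymatroid_polytope f) ones).
Proof.
apply: normal_fan_eq => [w|w|w w'].
- exact: MPP_argmax_nonempty.
- by have [x xw] := argmax_Psis_nonempty hf w; exists x; apply: argmax_hull.
- rewrite /pivot_polytope -argmax_hull_sub; last exact: argmax_Psis_nonempty.
  rewrite argmax_Psis_refines//; split; first exact: MPP_refines.
  exact: refines_MPP.
Qed.
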